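(* Let $P$ be a presentation satisfying condition $\zeta$ or condition $\tau$, and without proper powers (i.e. no relator is a proper power in the free group on the generators). Then $P$ is diagrammatically reducible (DR).
   Context: **Presentations and diagrams.** For a presentation $P=\langle X\mid R\rangle$ the relators are assumed cyclically reduced, and no relator is a cyclic permutation of another relator or of the inverse of another relator. $R^*$ is the set of all cyclic permutations of elements of $R$ and of their inverses. $K_P$ is the standard $2$-complex of $P$. A diagram over $P$ is a combinatorial map $\varphi\colon M\to K_P$ (open cells map homeomorphically onto open cells), where $M$ is obtained from a combinatorial cell structure on the $2$-sphere by removing some (possibly none) open $2$-cells; it is a spherical, disk or annular diagram if respectively $0$, $1$, $2$ open $2$-cells are removed. $\partial M$ is the boundary of $M$ in the sphere. Cells of dimension $0,1,2$ are called vertices, edges, faces. Via $\varphi$, edges of $M$ are labeled by elements of $X$ and their inverses, and the boundary label of an oriented face, read from any vertex, is an element of $R^*$. A diagram is reducible if it contains two faces $f,f'$ such that $\partial f\cap\partial f'$ contains an edge $e$ for which the boundary labels of $f$ and $f'$, read with opposite orientations and starting at an endpoint of $e$ (traversing $e$ first), coincide; otherwise it is reduced. A vertex is interior if it is not in $\partial M$; a face $f$ is interior if (its closure) $f$ satisfies $f\cap\partial M=\emptyset$. **Convention.** In a reduced diagram, interior vertices of degree $2$ are removed (merging the two incident edges). In the resulting cell structure, the degree $d(v)$ of a vertex $v$ is the number of edges incident to $v$ (loops counted twice) and the degree $d(f)$ of a face $f$ is the number of edges in its boundary (counted with multiplicity). **Condition $\zeta$.** For a face $f$ put $d_V(f)=\sum_{v\in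 f}\frac{2}{d(v)}$, the sum over the vertices of the boundary of $f$ (one term for each corner of $f$). $P$ satisfies $\zeta$ if $d_V(f)\le d(f)-2$ for every interior face $f$ of every reduced diagram over $P$. **Condition $\tau$.** For a vertex $v$ put $d_F(v)=\sum_{c\ni v}\frac{2}{d(f(c))}$, the sum over all corners $c$ at $v$, where $f(c)$ is the face containing the corner $c$. $P$ satisfies $\tau$ if in every reduced diagram over $P$ one has $d_F(v)\le d(v)-2$ for every interior vertex $v$, and every face has degree at least $3$. **DR.** A presentation $P$ with no proper powers is DR if all spherical diagrams over $P$ are reducible. *)

(* Defs.v *)
From mathcomp Require Import all_boot all_order all_fingroup all_algebra.

Set Implicit Arguments.
Unset Strict Implicit.
Unset Printing Implicit Defensive.

Import Order.TTheory GRing.Theory Num.Theory.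
Local Open Scope ring_scope.

(* [(x, false)] is the generator x and [(x, true)] is its inverse. *)
Definition letter (X : Type) : Type := (X * bool)%type.

Definition inv_letter (X : Type) (a : letter X) : letter X := (a.1, ~~ a.2).

Definition inv_word (X : Type) (w : seq (letter X)) : seq (letter X) :=
  rev (map (@inv_letter X) w).

Definition cyclic_perm (X : Type) (w w' : seq (letter X)) : Prop :=
  exists n : nat, w' = rot n w.

Definition cyclically_reduced (X : Type) (w : seq (letter X)) : Prop :=
  forall (n : nat) (a : letter X) (s : seq (letter X)),
    rot n w <> [:: a, inv_letter a & s].

(* Two words represent the same element of the free group on X. *)
Inductive free_eq (X : Type) : seq (letter X) -> seq (letter X) -> Prop :=
| free_refl w : free_eq w w
| free_sym w w' : free_eq w w' -> free_eq w' w
| free_trans w w' w'' : free_eq w w' -> free_eq w' w'' -> free_eq w w''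
| free_cancel u v a : free_eq (u ++ [:: a, inv_letter a & v]) (u ++ v).

(* The identity is the square of itself, so the empty word is a proper power. *)
Definition proper_power (X : Type) (w : seq (letter X)) : Prop :=
  exists (s : seq (letter X)) (n : nat),
    (1 < n)%N /\ free_eq w (flatten (nseq n s)).

Record presentation : Type := Presentation {
  gens : Type;
  relator : seq (letter gens) -> Prop;
  relator_reduced : forall r, relator r -> cyclically_reduced r;
  relator_distinct : forall r r', relator r -> relator r' -> r <> r' ->
    ~ cyclic_perm r r' /\ ~ cyclic_perm (inv_word r) r'
}.

Definition no_proper_powers (P : presentation) : Prop :=
  forall r, @relator P r -> ~ proper_power r.

Definition rel_star (P : presentation) (w : seq (letter (gens P))) : Prop :=
  exists2 r, relator r & cyclic_perm r w \/ cyclic_perm (inv_word r) w.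

(* A combinatorial cell structure on the oriented 2-sphere is encoded by its
   finite set of darts (oriented edges).  [edge] reverses a dart; [face] maps a
   dart x to the dart following x on the boundary of the face on the left of x.
   Hence [edge * face], which maps x to [face (edge x)], permutes the darts with
   the same origin as x, and vertices, edges and faces are the orbits of
   [node], [edge] and [face].  A connected structure of this kind is a cell
   decomposition of a closed oriented surface, which is the sphere exactly when
   V - E + F = 2.  The only structure left out is the one without edges: its
   face would need the empty word (a proper power) as a relator, and removing
   that face leaves a single vertex, which is not interior.

   A dart x also stands for the vertex at its origin, for the face on its left,
   and for the corner of that face at that vertex. *)
Record sphere : Type := Sphere {
  dart : finType;
  edge : {perm dart};
  face : {perm dart};
  edgeK : involutive edge;
  edge_neq : forall x, edge x != x;
  sphere_connected : forall x y,
    connect (fun a b => (b == edge a) || (b == face a)) x y;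
  sphere_euler :
    (#|porbits (edge * face)%g| + #|porbits face| = #|porbits edge| + 2)%N
}.

Definition node (S : sphere) : {perm dart S} := (@edge S * @face S)%g.

(* [rface x] is the dart following x when the face on the right of x is read
   with the opposite orientation. *)
Definition rface (S : sphere) : {perm dart S} :=
  (@edge S * (@face S)^-1 * @edge S)%g.

Definition read (X : Type) (D : finType) (l : D -> letter X) (s : {perm D})
    (x : D) : seq (letter X) :=
  map l (traject s x #|porbit s x|).

(* [removed] consists of the darts on the left of which lies a removed 2-cell.
   As relators are not cyclic permutations of one another or of one another's
   inverses, the label of a face determines the 2-cell of K_P onto which it is
   mapped, so a combinatorial map to K_P amounts to a labeling. *)
Record diagram (P : presentation) : Type := Diagram {
  carrier :> sphere;
  removed : {set dart carrier};
  removed_face : forall x, (face carrier x \in removed) = (x \in removed);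
  label : dart carrier -> letter (gens P);
  label_edge : forall x, label (edge carrier x) = inv_letter (label x);
  label_face : forall x, x \notin removed -> rel_star (read label (face carrier) x)
}.

Definition spherical (P : presentation) (M : diagram P) : Prop :=
  removed M = set0.

(* The two words below start with the same edge, read from the origin of x. *)
Definition reducible (P : presentation) (M : diagram P) : Prop :=
  exists x : dart M,
    [/\ x \notin removed M,
        edge M x \notin removed M,
        porbit (face M) x != porbit (face M) (edge M x)
      & read (@label P M) (face M) x = read (@label P M) (rface M) x].

Definition reduced (P : presentation) (M : diagram P) : Prop := ~ reducible M.

(* The boundary of M is the union of the boundaries of the removed 2-cells. *)
Definition interior_vertex (P : presentation) (M : diagram P) (x : dart M) : bool :=
  [forall y in porbit (node M) x, y \notin removed M].

(* An edge in the boundary of M has its endpoints there too, so a closed face is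
   disjoint from the boundary of M as soon as its vertices are. *)
Definition interior_face (P : presentation) (M : diagram P) (x : dart M) : bool :=
  (x \notin removed M) && [forall y in porbit (face M) x, interior_vertex y].

(* The degree of a vertex is not affected by the removal of other vertices. *)
Definition vdeg (P : presentation) (M : diagram P) (x : dart M) : nat :=
  #|porbit (node M) x|.

Definition erased (P : presentation) (M : diagram P) (x : dart M) : bool :=
  interior_vertex x && (vdeg x == 2)%N.

(* Interior vertices of degree 2 are erased, and consecutive darts of a face
   separated by an erased vertex are merged. *)
Definition merged (P : presentation) (M : diagram P) : rel (dart M) :=
  fun x y => ((y == face M x) && erased y) || ((x == face M y) && erased x).

(* The edges on the boundary of a face, with multiplicity, are the classes of
   its darts under the equivalence relation generated by [merged]. *)
Definition fdeg (P : presentation) (M : diagram P) (x : dart M) : nat :=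
  #|equivalence_partition (connect (@merged P M)) (porbit (face M) x)|.

Definition dV (P : presentation) (M : diagram P) (x : dart M) : rat :=
  \sum_(y in porbit (face M) x | ~~ erased y) 2 / (vdeg y)%:R.

Definition dF (P : presentation) (M : diagram P) (x : dart M) : rat :=
  \sum_(y in porbit (node M) x) 2 / (fdeg y)%:R.

Definition zeta (P : presentation) : Prop :=
  forall M : diagram P, reduced M ->
  forall x : dart M, interior_face x -> dV x <= (fdeg x)%:R - 2.

Definition tau (P : presentation) : Prop :=
  forall M : diagram P, reduced M ->
    (forall x : dart M, interior_vertex x -> ~~ erased x ->
       dF x <= (vdeg x)%:R - 2)
    /\ (forall x : dart M, x \notin removed M -> (3 <= fdeg x)%N).

Definition DR (P : presentation) : Prop :=
  forall M : diagram P, spherical M -> reducible M.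

(* Main.v *)
Require Import Defs.
From mathcomp Require Import all_boot all_order all_fingroup all_algebra.
From mathcomp Require Import lra.
From Stdlib Require Import Classical.

Set Implicit Arguments.
Unset Strict Implicit.
Unset Printing Implicit Defensive.

Import Order.TTheory GRing.Theory Num.Theory.
Local Open Scope ring_scope.

(** Suppose that some spherical diagram M were reduced.  All its vertices and
    faces are interior, so the curvature condition applies everywhere.  Summing
    zeta over the faces, or tau over the vertices, gives V + F <= E, against
    Euler's formula V + F = E + 2.

    Write n(v) for the number of darts at v, and n'(f) for the number of corners
    of f at vertices that survive the erasure of vertices of degree 2.
    - Under zeta, the left-hand sides add up to 2 for each surviving vertex.
      As d(f) <= n'(f) and the n'(f) add up to the number of corners at
      surviving vertices, the right-hand sides add up to at most that number
      minus 2F.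
    - Under tau, the left-hand sides regroup by faces as the sum of
      n'(f) * 2 / d(f), which is at least 2F, and the right-hand sides add up
      to the sum of n(v) - 2 over the surviving vertices.
    Either way the result is that 2F is at most the sum of n(v) - 2 over the
    surviving vertices.  An erased vertex has n(v) - 2 = 0, so this sum equals
    its extension to all vertices, which is 2E - 2V.  Hence V - E + F can be
    computed in M itself, before any merging: all sums are taken over the darts
    of M, a cell with k darts being counted with weight 1 / k on each of them
    ([sum_inv_card_porbit]).

    The only fact on merged edges is d(f) <= n'(f) ([fdeg_le_corners]): every
    merged edge starts at a surviving corner.  It fails exactly for a face all
    of whose corners are erased, where d(f) = 1 and n'(f) = 0, and both zeta and
    tau exclude this since they force d(f) >= 2. *)

(** * Sums over the orbits of a permutation *)

Section OrbitSums.

Variables (R : numFieldType) (T : finType).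
Implicit Types (s : {perm T}) (F G : T -> R).

Lemma sum_porbits s F :
  \sum_y F y = \sum_(A in porbits s) \sum_(y in A) F y.
Proof.
rewrite (partition_big_imset (porbit s)) /=.
apply: eq_bigr => _ /imsetP[x _ ->]; apply: eq_bigl => y.
by rewrite eq_porbit_mem.
Qed.

Lemma ler_sum_porbits s F G :
    (forall x, \sum_(y in porbit s x) F y <= \sum_(y in porbit s x) G y) ->
  \sum_y F y <= \sum_y G y.
Proof.
move=> leFG; rewrite !(sum_porbits s).
by apply: ler_sum => _ /imsetP[x _ ->].
Qed.

Lemma sum_porbit_inv_card s x :
  \sum_(y in porbit s x) #|porbit s y|%:R^-1 = 1 :> R.
Proof.
rewrite (eq_bigr (fun=> #|porbit s x|%:R^-1)) => [|y]; last first.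
  by rewrite -eq_porbit_mem => /eqP->.
by rewrite sumr_const -(mulr_natr _^-1) mulVf // pnatr_eq0 card_porbit_neq0.
Qed.

Lemma sum_inv_card_porbit s :
  \sum_y #|porbit s y|%:R^-1 = #|porbits s|%:R :> R.
Proof.
rewrite (sum_porbits s) (eq_bigr (fun=> 1)) ?sumr_const // => _ /imsetP[x _ ->].
exact: sum_porbit_inv_card.
Qed.

End OrbitSums.

Lemma card_porbit_involution (T : finType) (s : {perm T}) x :
  involutive s -> s x != x -> #|porbit s x| = 2.
Proof.
move=> sK sx; suff ->: porbit s x = [set x; s x] by rewrite cards2 eq_sym sx.
apply/setP=> y; rewrite !inE; apply/porbitP/orP => [[i ->]|].
  rewrite permX; elim: i => [|i [] /eqP /= ->]; first by left.
    by right.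
  by left; rewrite sK.
by case=> /eqP->; [exists 0; rewrite perm1 | exists 1; rewrite expg1].
Qed.

(** * Merging consecutive points of an orbit *)

Section Merging.

Variables (T : finType) (s : {perm T}) (B : pred T).

(** [merged] is the case of the face permutation and of the erased corners.
    Only the cyclic order given by [s] matters for counting classes. *)
Definition merge : rel T :=
  fun x y => ((y == s x) && B y) || ((x == s y) && B x).

Lemma merge_connect_sym : connect_sym merge.
Proof. by apply: sym_connect_sym => x y; rewrite /merge orbC. Qed.

(** Walking backwards from [x], the merged edge of [x] can only be left at a
    point outside [B], and that point is the start of this edge. *)
Lemma connect_merge_start x y : y \in porbit s x ->
  connect merge x y \/
  exists z, [/\ z \in porbit s x, ~~ B z & connect merge x z].
Proof.
rewrite -porbitV => /porbitP[i ->]; elim: i => [|i IHi].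
  by left; rewrite perm1.
case: IHi => [xy | ?]; last by right.
have [By | nBy] := boolP (B ((s^-1 ^+ i)%g x)); last first.
  by right; exists ((s^-1 ^+ i)%g x); split=> //; apply: mem_porbit.
left; apply: (connect_trans xy); apply: connect1.
by rewrite /merge expgSr permM permKV eqxx By orbT.
Qed.

Lemma card_merge_classes x :
  (#|equivalence_partition (connect merge) (porbit s x)|
     <= maxn 1 #|[set y in porbit s x | ~~ B y]|)%N.
Proof.
set O := porbit s x; set NB := [set y in O | ~~ B y].
pose C y := [set z in O | connect merge y z].
have eqC y z : connect merge y z -> C y = C z.
  move=> yz; apply/setP=> t; rewrite !inE.
  by rewrite (same_connect merge_connect_sym yz).
have orbO y : y \in O -> porbit s y = O.
  by rewrite -eq_porbit_mem => /eqP.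
have [NB0 | /set0Pn[z0]] := eqVneq NB set0.
  (* a wholly erased orbit is a single class *)
  rewrite leq_max; apply/orP; left; rewrite -(cards1 (C x)); apply: subset_leq_card.
  apply/subsetP=> _ /imsetP[y Oy ->]; rewrite inE; apply/eqP.
  apply/esym/eqC; case: (connect_merge_start Oy) => [// | [z [Oz nBz _]]].
  by have := in_set0 z; rewrite -NB0 inE -/O Oz nBz.
rewrite inE => /andP[Oz0 nBz0]; rewrite leq_max; apply/orP; right.
apply: leq_trans (leq_imset_card C NB); apply: subset_leq_card.
apply/subsetP=> _ /imsetP[y Oy ->].
have [z [Oz nBz yz]] :
    exists z, [/\ z \in O, ~~ B z & connect merge y z].
  have z0y : z0 \in porbit s y by rewrite orbO.
  case: (connect_merge_start z0y) => [yz0 | [z]]; first by exists z0.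
  by rewrite orbO // => -[? ? ?]; exists z.
by apply/imsetP; exists z; rewrite ?inE ?Oz //; apply: eqC.
Qed.

End Merging.

(** * Counting the cells of a spherical diagram *)

Lemma fdeg_le_corners (P : presentation) (M : diagram P) x :
    (1 < fdeg x)%N ->
  (fdeg x <= #|[set y in porbit (face M) x | ~~ erased y]|)%N.
Proof.
move=> d_gt1; have := card_merge_classes (face M) (@erased P M) x.
by rewrite -[#|equivalence_partition _ _|]/(fdeg x) leq_max leqNgt d_gt1.
Qed.

Lemma sum_corners_ge_fdeg (P : presentation) (M : diagram P) x :
    (1 < fdeg x)%N ->
  (fdeg x)%:R <= \sum_(y in porbit (face M) x) (~~ erased y)%:R :> rat.
Proof.
move=> /fdeg_le_corners; rewrite -(ler_nat rat) => /le_trans; apply.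
rewrite -sum1_card natr_sum; under eq_bigl do rewrite inE.
by rewrite big_mkcondr; apply: ler_sum => y _; case: (erased y).
Qed.

Lemma fdeg_face (P : presentation) (M : diagram P) (x y : dart M) :
  y \in porbit (face M) x -> fdeg y = fdeg x.
Proof. by rewrite -eq_porbit_mem /fdeg => /eqP->. Qed.

Lemma vdeg_node (P : presentation) (M : diagram P) (x y : dart M) :
  y \in porbit (node M) x -> vdeg y = vdeg x.
Proof. by rewrite -eq_porbit_mem /vdeg => /eqP->. Qed.

Section Spherical.

Variables (P : presentation) (M : diagram P).
Hypothesis sphM : spherical M.

Lemma spherical_removed x : x \notin removed M.
Proof. by rewrite sphM inE. Qed.

Lemma spherical_interior_vertex (x : dart M) : interior_vertex x.
Proof. by apply/forall_inP=> y _; apply: spherical_removed. Qed.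

Lemma spherical_interior_face (x : dart M) : interior_face x.
Proof.
rewrite /interior_face spherical_removed; apply/forall_inP=> y _.
exact: spherical_interior_vertex.
Qed.

Lemma spherical_erased (x : dart M) : erased x = (vdeg x == 2).
Proof. by rewrite /erased spherical_interior_vertex. Qed.

Lemma card_dart : #|dart M|%:R = 2 * #|porbits (edge M)|%:R :> rat.
Proof.
rewrite -sum_inv_card_porbit mulr_sumr -sum1_card natr_sum.
apply: eq_bigr => x _; rewrite card_porbit_involution ?divff //.
  exact: edgeK.
exact: edge_neq.
Qed.

Let sum_vertices :
  \sum_x (vdeg x)%:R^-1 = #|porbits (node M)|%:R :> rat :=
  sum_inv_card_porbit rat (node M).

Let sum_faces :
  \sum_x #|porbit (face M) x|%:R^-1 = #|porbits (face M)|%:R :> rat :=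
  sum_inv_card_porbit rat (face M).

Lemma sum_darts : \sum_(x : dart M) 1 = 2 * #|porbits (edge M)|%:R :> rat.
Proof. by rewrite -card_dart sumr_const. Qed.

Lemma euler_contradiction :
  2 * #|porbits (node M)|%:R + 2 * #|porbits (face M)|%:R
    <= 2 * #|porbits (edge M)|%:R :> rat -> False.
Proof.
have := congr1 (fun n => n%:R : rat) (sphere_euler M).
rewrite -/(node M) !natrD; lra.
Qed.

(** The comparison is made with 1 - 2 / d(v) at each corner; erased corners have
    d(v) = 2 and so contribute 0. *)
Lemma tau_contradiction :
    (forall x : dart M, ~~ erased x -> dF x <= (vdeg x)%:R - 2) ->
    (forall x : dart M, (3 <= fdeg x)%N) ->
  False.
Proof.
move=> le_dF fdeg_ge3; apply: euler_contradiction.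
pose w (y : dart M) : rat := (~~ erased y)%:R * (2 / (fdeg y)%:R).
have le_by_vertex :
    \sum_y w y <= \sum_(y : dart M) (1 - 2 * (vdeg y)%:R^-1).
  apply: (@ler_sum_porbits _ _ (node M)) => x.
  have [ex | nex] := boolP (erased x).
    rewrite !big1 // => y yx; have := vdeg_node yx.
      by move: ex; rewrite spherical_erased => /eqP-> ->; rewrite divff ?subrr.
    by rewrite /w spherical_erased => ->; rewrite -spherical_erased ex mul0r.
  have -> : \sum_(y in porbit (node M) x) w y = dF x.
    apply: eq_bigr => y /vdeg_node yx.
    by rewrite /w spherical_erased yx -spherical_erased nex mul1r.
  apply: le_trans (le_dF x nex) _; rewrite sumrB -mulr_sumr.
  by rewrite sum_porbit_inv_card mulr1 sumr_const.
have le_by_face :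
    \sum_(y : dart M) 2 * #|porbit (face M) y|%:R^-1 <= \sum_y w y.
  apply: (@ler_sum_porbits _ _ (face M)) => x.
  rewrite -mulr_sumr sum_porbit_inv_card mulr1.
  rewrite (eq_bigr (fun y => (~~ erased y)%:R * (2 / (fdeg x)%:R))); last first.
    by move=> y /fdeg_face yx; rewrite /w yx.
  have d_gt1 := ltnW (fdeg_ge3 x).
  have d_gt0 : 0 < (fdeg x)%:R :> rat by rewrite ltr0n ltnW.
  by rewrite -mulr_suml mulrCA -ler_pdivrMl // mulVf // ler_pdivlMr // mul1r
             sum_corners_ge_fdeg.
have := le_trans le_by_face le_by_vertex.
by rewrite sumrB -!mulr_sumr sum_vertices sum_faces sum_darts; lra.
Qed.

(** Each corner carries 2 / d(v) on the left and 1 on the right, and both sides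
    drop the erased corners: these count 1 on either side, as d(v) = 2. *)
Lemma zeta_contradiction :
  (forall x : dart M, dV x <= (fdeg x)%:R - 2) -> False.
Proof.
move=> le_dV; apply: euler_contradiction.
suff : \sum_(y : dart M) (2 * (vdeg y)%:R^-1 - (erased y)%:R) <=
       \sum_(y : dart M) (1 - (erased y)%:R - 2 * #|porbit (face M) y|%:R^-1) :> rat.
  rewrite !sumrB -!mulr_sumr sum_vertices sum_faces sum_darts; lra.
apply: (@ler_sum_porbits _ _ (face M)) => x.
have -> : \sum_(y in porbit (face M) x) (2 * (vdeg y)%:R^-1 - (erased y)%:R)
          = dV x :> rat.
  rewrite /dV big_mkcondr; apply: eq_bigr => y _.
  rewrite spherical_erased; have [-> | _] := eqVneq; last by rewrite subr0.
  by rewrite divff ?subrr.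
have d_gt1 : (1 < fdeg x)%N.
  have dV_ge0 : 0 <= dV x by apply: sumr_ge0 => y _; rewrite divr_ge0 ?ler0n.
  by have := le_trans dV_ge0 (le_dV x); rewrite subr_ge0 ler_nat.
apply: le_trans (le_dV x) _.
rewrite sumrB -mulr_sumr sum_porbit_inv_card mulr1 lerD2r.
apply: le_trans (sum_corners_ge_fdeg d_gt1) _.
by apply: ler_sum => y _; case: (erased y); rewrite ?subrr ?subr0.
Qed.

End Spherical.

Theorem theorem6p6 (P : presentation)
    (condP : zeta P \/ tau P) (no_powers : no_proper_powers P) :
  DR P.
Proof.
move=> M sphM.
have [//|redM] := classic (reducible M); exfalso.
case: condP => [zetaP | tauP].
  apply: (zeta_contradiction sphM) => x.
  exact: zetaP redM _ (spherical_interior_face sphM x).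
have [vtx fc] := tauP M redM.
apply: (tau_contradiction sphM) => x; last exact: fc (spherical_removed sphM x).
exact: vtx (spherical_interior_vertex sphM x).
Qed.
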